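(* Let $A$ be a unital prime ring and let $a\in A$. The following conditions are equivalent: (1) $a\in A^\wedge$ and $a$ is maximal with respect to the relation $\leq^-$, i.e. whenever $b\in A$ and $a\leq^- b$, then $b=a$. (2) $a\in A^{-1}_l\cup A^{-1}_r$.
   Context: An element $a$ of a unital ring $A$ is regular if there is $x\in A$ with $axa=a$; $A^\wedge$ is the set of regular elements and $A^\bullet$ the set of idempotents. $A^{-1}_l$ and $A^{-1}_r$ denote the sets of left invertible and right invertible elements of $A$, respectively. Write $\mathrm{ann}_l(a)=\{x\in A: xa=0\}$ and $\mathrm{ann}_r(a)=\{x\in A: ax=0\}$. For $a,b\in A$, $a\leq^- b$ means that there exist $p,q\in A^\bullet$ with $\mathrm{ann}_l(a)=\mathrm{ann}_l(p)$, $\mathrm{ann}_r(a)=\mathrm{ann}_r(q)$, $pa=pb$ and $aq=bq$. A ring $A$ is prime if $aAb=\{0\}$ implies $a=0$ or $b=0$. *)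

(* Defs.v *)
From mathcomp Require Import all_boot all_algebra.
From mathcomp Require Import boolp classical_sets.

Set Implicit Arguments.
Unset Strict Implicit.
Unset Printing Implicit Defensive.

Import GRing.Theory.
Local Open Scope ring_scope.
Local Open Scope classical_set_scope.

Section Defs.
Variable A : pzRingType.
Implicit Types a b p q x : A.

Definition regular_elements : set A := [set a | exists x, a * x * a = a].

Definition idempotents : set A := [set p | p * p = p].

Definition left_invertibles : set A := [set a | exists x, x * a = 1].
Definition right_invertibles : set A := [set a | exists x, a * x = 1].

Definition ann_l a : set A := [set x | x * a = 0].
Definition ann_r a : set A := [set x | a * x = 0].

Definition minus_le a b : Prop :=
  exists p q, [/\ idempotents p /\ idempotents q,
    ann_l a = ann_l p, ann_r a = ann_r q, p * a = p * b & a * q = b * q].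

Definition minus_maximal a : Prop := forall b, minus_le a b -> b = a.

End Defs.

Arguments regular_elements : clear implicits.
Arguments idempotents : clear implicits.
Arguments left_invertibles : clear implicits.
Arguments right_invertibles : clear implicits.

(* The zero ring counts as prime, since 0 != 1 is not required. *)
Definition prime_ring (A : pzRingType) : Prop :=
  forall a b : A, (forall x : A, a * x * b = 0) -> a = 0 \/ b = 0.

(* Main.v *)
(* If a = axa, then every b = a + (1 - ax) y (1 - xa) lies above a, so
   maximality forces (1 - ax) A (1 - xa) = 0, and primeness gives ax = 1 or
   xa = 1. Conversely, if a is left invertible then ann_r(q) = ann_r(a) = 0
   contains 1 - q, so q = 1 and aq = bq reads a = b; symmetrically on the right. *)
Require Import Defs.
From mathcomp Require Import all_boot all_algebra.
From mathcomp Require Import boolp classical_sets.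

Import GRing.Theory.

Local Open Scope ring_scope.
Local Open Scope classical_set_scope.

(** Each of [a] and [a * x] is a right multiple of the other. *)
Lemma ann_l_mul_inner_inverse (A : pzRingType) (a x : A) :
  a * x * a = a -> ann_l a = ann_l (a * x).
Proof.
move=> axa; apply/seteqP; rewrite /ann_l; split=> z /= z0; first by rewrite mulrA z0 mul0r.
by rewrite -axa mulrA z0 mul0r.
Qed.

Lemma ann_r_mul_inner_inverse (A : pzRingType) (a x : A) :
  a * x * a = a -> ann_r a = ann_r (x * a).
Proof.
move=> axa; apply/seteqP; rewrite /ann_r; split=> z /= z0; first by rewrite -mulrA z0 mulr0.
by rewrite -axa -!mulrA [x * _]mulrA z0 mulr0.
Qed.

(** The idempotents [a * x] and [x * a] serve as witnesses: the first kills [1 - a * x] from the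
    left, the second kills [1 - x * a] from the right, so the added term vanishes in both
    equations. *)
Lemma minus_le_add_corner (A : pzRingType) (a x y : A) :
  a * x * a = a -> minus_le a (a + (1 - a * x) * y * (1 - x * a)).
Proof.
move=> axa; have xaxa : x * a * (x * a) = x * a by rewrite -mulrA [a * _]mulrA axa.
have axax : a * x * (a * x) = a * x by rewrite mulrA axa.
exists (a * x), (x * a); split=> //.
- exact: ann_l_mul_inner_inverse.
- exact: ann_r_mul_inner_inverse.
- by rewrite mulrDr !(mulrA (a * x)) (mulrBr (a * x)) mulr1 axax subrr !mul0r addr0.
- by rewrite mulrDl -(mulrA _ (1 - x * a)) (mulrBl (x * a)) mul1r xaxa subrr mulr0 addr0.
Qed.

Lemma left_invertible_minus_maximal (A : pzRingType) (a : A) :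
  left_invertibles A a -> minus_maximal a.
Proof.
case=> x xa b [p [q [[_ qq] _ ann_aq _ aq]]].
have : ann_r q (1 - q) by rewrite /ann_r /= mulrBr mulr1 qq subrr.
rewrite -ann_aq /ann_r /= => aq0.
(* Here [1 - q = x * a * (1 - q)], and [a * (1 - q) = 0]. *)
have /eqP : 1 - q = 0 by rewrite -[LHS]mul1r -{1}xa -mulrA aq0 mulr0.
by rewrite subr_eq0 => /eqP q1; move: aq; rewrite -q1 !mulr1.
Qed.

Lemma right_invertible_minus_maximal (A : pzRingType) (a : A) :
  right_invertibles A a -> minus_maximal a.
Proof.
case=> x ax b [p [q [[pp _] ann_ap _ pa _]]].
have : ann_l p (1 - p) by rewrite /ann_l /= mulrBl mul1r pp subrr.
rewrite -ann_ap /ann_l /= => pa0.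
have /eqP : 1 - p = 0 by rewrite -[LHS]mulr1 -{2}ax mulrA pa0 mul0r.
by rewrite subr_eq0 => /eqP p1; move: pa; rewrite -p1 !mul1r.
Qed.

Theorem proposition2p13 (A : pzRingType) (prime_A : prime_ring A) (a : A) :
  (regular_elements A a /\ minus_maximal a) <->
  (left_invertibles A `|` right_invertibles A) a.
Proof.
split=> [[[x axa] max_a]|[inv_a|inv_a]].
- have corner0 y : (1 - a * x) * y * (1 - x * a) = 0.
    by apply: (addrI a); rewrite addr0; apply/max_a/minus_le_add_corner.
  (* The first factor being zero makes [x] a right inverse of [a], the second a left inverse. *)
  by case: (prime_A _ _ corner0) => /eqP; rewrite subr_eq0 eq_sym => /eqP ?;
    [right | left]; exists x.
- split; last exact: left_invertible_minus_maximal.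
  (* A one-sided inverse is also an inner inverse: [a * (x * a) = a * 1]. *)
  by case: inv_a => x xa; exists x; rewrite -mulrA xa mulr1.
- split; last exact: right_invertible_minus_maximal.
  by case: inv_a => x ax; exists x; rewrite ax mul1r.
Qed.
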